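(* Let $B$ be a generalized Bratteli diagram. If the path space $X_B$ has a point with a compact neighbourhood, then $B$ is relatively irreducible.
   Context: A generalized Bratteli diagram is a graded graph $B=(V,E)$ with $V=\bigsqcup_{n\ge 0}V_n$ and $E=\bigsqcup_{n\ge 0}E_n$ such that: (i) each level $V_n$ and each edge set $E_n$ is countably infinite; (ii) there are source and range maps $s,r$ on $E$ with $s(E_n)=V_n$ and $r(E_n)=V_{n+1}$; (iii) $|r^{-1}(v)|<\infty$ for every $v\in V\setminus V_0$. Multiple edges are allowed. All levels $V_n$ are identified with one and the same countably infinite set (such as $\mathbb{N}$, $\mathbb{N}_0=\mathbb{N}\cup\{0\}$ or $\mathbb{Z}$); this enumeration is part of the data. A finite path from $w\in V_n$ to $v\in V_m$ ($m>n$) is a sequence of edges $(e_n,\dots,e_{m-1})$, $e_k\in E_k$, with $s(e_n)=w$, $s(e_k)=r(e_{k-1})$, $r(e_{m-1})=v$. The path space $X_B$ is the set of all infinite paths $x=(x_n)_{n\ge0}$, $x_n\in E_n$, $s(x_{n+1})=r(x_n)$, with the topology generated by the cylinder sets $[(e_0,\dots,e_n)]=\{x\in X_B: x_0=e_0,\dots,x_n=e_n\}$. A neighbourhood of a point $x$ is any set that contains an open set containing $x$. $B$ is irreducible if, with all levels identified with the set $V_0$, for any $i,j\in V_0$ and any $n\in\mathbb{N}_0$ there exists $m>n$ such that there is a finite path from $i\in V_n$ to $j\in V_m$. Otherwise $B$ is reducible. Two diagrams $B=(V,E)$ and $B'=(V',E')$ are isomorphic if there are bijections $g_n:V_n\to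 V_n'$ and $h_n:E_n\to E_n'$ for all $n\in\mathbb{N}_0$ with $s'\circ h_n=g_n\circ s$ and $r'\circ h_n=g_{n+1}\circ r$ on $E_n$. (The bijections $g_n$ are not required to be compatible with the identifications of different levels.) $B$ is relatively irreducible if it is isomorphic both to some reducible and to some irreducible generalized Bratteli diagram. *)

(* Defs.v *)
From HB Require Import structures.
From mathcomp Require Import all_boot.
From mathcomp Require Import boolp classical_sets functions cardinality.
From mathcomp Require Import topology.

Set Implicit Arguments.
Unset Strict Implicit.
Unset Printing Implicit Defensive.

Local Open Scope classical_set_scope.
Local Open Scope card_scope.

(* All levels V_n are identified with the single countably infinite type
   [vertex]: the level V_n is the copy [{n} * vertex], and the index n is carried
   by the edge sets, [src : E_n -> V_n] and [rng : E_n -> V_{n+1}]. *)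
Record bratteli : Type := Bratteli {
  vertex : Type;
  edge : nat -> Type;
  src : forall n, edge n -> vertex;
  rng : forall n, edge n -> vertex;
  vertex_countably_infinite : [set: vertex] #= [set: nat];
  edge_countably_infinite : forall n, [set: edge n] #= [set: nat];
  src_surj : forall n (v : vertex), exists e : edge n, src e = v;
  rng_surj : forall n (v : vertex), exists e : edge n, rng e = v;
  rng_finite : forall n (v : vertex), finite_set [set e : edge n | rng e = v]
}.
Arguments src _ {n} _.
Arguments rng _ {n} _.

(* A finite path (e_n, ..., e_{m-1}) is represented by a full sequence of edges
   of which only the terms with n <= k < m are looked at.  No path is lost, nor
   is one added, since every edge set is nonempty. *)
Definition finite_path (B : bratteli) (n m : nat)
    (e : forall k, edge B k) : Prop :=
  (n < m)%N /\
  forall k, (n <= k)%N -> (k.+1 < m)%N -> src B (e k.+1) = rng B (e k).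

Definition finite_path_from_to (B : bratteli) (n m : nat) (w v : vertex B)
    (e : forall k, edge B k) : Prop :=
  [/\ finite_path n m e, src B (e n) = w & rng B (e m.-1) = v].

Record path_space (B : bratteli) : Type := PathSpace {
  path_edge :> forall n, edge B n;
  path_edgeP : forall n, src B (path_edge n.+1) = rng B (path_edge n)
}.

HB.instance Definition _ (B : bratteli) := gen_eqMixin (path_space B).
HB.instance Definition _ (B : bratteli) := gen_choiceMixin (path_space B).

Definition cylinder (B : bratteli) (m : nat) (e : forall k, edge B k) :
    set (path_space B) :=
  [set x | forall k, (k < m)%N -> x k = e k].

Definition cylinders (B : bratteli) : set (set (path_space B)) :=
  [set C | exists m (e : forall k, edge B k),
     finite_path 0 m e /\ C = cylinder m e].

HB.instance Definition _ (B : bratteli) :=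
  isSubBaseTopological.Build (path_space B) (@cylinders B) id.

Definition irreducible (B : bratteli) : Prop :=
  forall (i j : vertex B) (n : nat), exists m, (n < m)%N /\
    exists e : forall k, edge B k, finite_path_from_to n m i j e.

Definition reducible (B : bratteli) : Prop := ~ irreducible B.

Definition isomorphic (B B' : bratteli) : Prop :=
  exists (g : forall n : nat, vertex B -> vertex B')
         (h : forall n : nat, edge B n -> edge B' n),
    [/\ forall n, bijective (g n),
        forall n, bijective (h n),
        forall n (e : edge B n), src B' (h n e) = g n (src B e)
      & forall n (e : edge B n), rng B' (h n e) = g n.+1 (rng B e)].

Definition relatively_irreducible (B : bratteli) : Prop :=
  (exists B' : bratteli, isomorphic B B' /\ reducible B') /\
  (exists B' : bratteli, isomorphic B B' /\ irreducible B').

(* Main.v *)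
Require Import Defs.
From HB Require Import structures.
From mathcomp Require Import all_boot finmap.
From mathcomp Require Import boolp classical_sets functions cardinality.
From mathcomp Require Import topology.

(** Relabelling every level independently is an isomorphism.  Since every vertex
    emits an edge, paths from any vertex reach every later level; serving the
    countably many requirements "a path from w in V_n must reach the label j" at
    pairwise distinct levels m > n, by relabelling one vertex of V_m as j, makes
    any diagram irreducible.  Conversely, if a cylinder of depth m lies in a
    compact set, then the vertices visited at level k by paths of that cylinder
    form a finite set, so the label of some j can be moved off this set at every
    level: j is then out of reach of the vertex of V_m where the cylinder ends. *)

Set Implicit Arguments.
Unset Strict Implicit.
Unset Printing Implicit Defensive.

Local Open Scope classical_set_scope.
Local Open Scope card_scope.

Lemma exists_bij_mapping (T : Type) (a b : T) :
  exists f : T -> T, bijective f /\ f a = b.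
Proof.
pose swap x := if pselect (x = a) then b else if pselect (x = b) then a else x.
exists swap; split; last by rewrite /swap; case: pselect.
exists swap; move=> x; rewrite /swap; do ![case: pselect => //=]; congruence.
Qed.

Section Relabelling.
Variables (B : bratteli) (g : nat -> vertex B -> vertex B).
Hypothesis g_bij : forall n, bijective (g n).

Let relabel_src n (e : edge B n) := g n (src B e).
Let relabel_rng n (e : edge B n) := g n.+1 (rng B e).

Let relabel_src_surj n v : exists e : edge B n, relabel_src e = v.
Proof.
by have [f _ fK] := g_bij n; have [e ev] := src_surj n (f v); exists e;
   rewrite /relabel_src ev fK.
Qed.

Let relabel_rng_surj n v : exists e : edge B n, relabel_rng e = v.
Proof.
by have [f _ fK] := g_bij n.+1; have [e ev] := rng_surj n (f v); exists e;
   rewrite /relabel_rng ev fK.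
Qed.

Let relabel_rng_finite n v : finite_set [set e : edge B n | relabel_rng e = v].
Proof.
have [f gK _] := g_bij n.+1.
apply: (sub_finite_set _ (rng_finite n (f v))) => e <- /=.
by rewrite /relabel_rng gK.
Qed.

Definition relabel : bratteli :=
  Bratteli (vertex_countably_infinite B) (@edge_countably_infinite B)
    relabel_src_surj relabel_rng_surj relabel_rng_finite.

Lemma isomorphic_relabel : isomorphic B relabel.
Proof. by exists g, (fun=> id); split => // n; exists id. Qed.

(** The range of [e k] and the source of [e k.+1] both lie in level [k.+1], so the same bijection
    [g k.+1] relabels them. *)
Lemma relabel_finite_path n m (e : forall k, edge B k) :
  finite_path (B := relabel) n m e <-> finite_path n m e.
Proof.
split=> -[nm eP]; split=> // k nk km; have := eP k nk km.
  exact: (bij_inj (g_bij k.+1)).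
exact: congr1.
Qed.

End Relabelling.

Section Extension.
Variable B : bratteli.

Definition out_edge n (v : vertex B) : edge B n := sval (cid (src_surj n v)).

Lemma src_out_edge n v : src B (out_edge n v) = v.
Proof. exact: svalP (cid (src_surj n v)). Qed.

Fixpoint extend (n : nat) (p : forall k, edge B k) (k : nat) : edge B k :=
  match k with
  | 0 => p 0
  | l.+1 => if (l < n)%N then p l.+1 else out_edge l.+1 (rng B (extend n p l))
  end.

Lemma extendE n p k : (k <= n)%N -> extend n p k = p k.
Proof. by case: k => [|k] //= ->. Qed.

Lemma src_extend n p k : (n <= k)%N ->
  src B (extend n p k.+1) = rng B (extend n p k).
Proof. by rewrite leqNgt => /negbTE /= ->; rewrite src_out_edge. Qed.

Lemma finite_path_from n m (w : vertex B) : (n < m)%N ->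
  exists e, finite_path n m e /\ src B (e n) = w.
Proof.
(* Only entry [n] of [out_edge^~ w] matters: it leaves [w], and [extend] replaces all later
   entries. *)
move=> nm; exists (extend n (out_edge^~ w)); split; last first.
  by rewrite extendE// src_out_edge.
by split=> // k nk _; rewrite src_extend.
Qed.

Lemma finite_path_extend m p : finite_path 0 m p ->
  exists y : path_space B, forall k, (k < m)%N -> y k = p k.
Proof.
case: m => [[]//|m [_ pP]].
have eP k : src B (extend m p k.+1) = rng B (extend m p k).
  case: (leqP m k) => [|km]; first exact: src_extend.
  by rewrite !extendE ?pP// ltnW.
by exists (PathSpace eP) => k km; exact: extendE.
Qed.

End Extension.

Section Compactness.
Variable B : bratteli.

(** The subbase comes from nonempty finite paths, hence the positive depth. *)
Lemma cylinder_path (x : path_space B) m : cylinders (cylinder m.+1 x).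
Proof. by exists m.+1, x; split=> //; split=> // k _ _; exact: path_edgeP. Qed.

Lemma open_cylinder (x : path_space B) m : open (cylinder m.+1 x).
Proof.
exists [set cylinder m.+1 x].
  by move=> _ ->; exact: (finI_from1 id (cylinder_path x m)).
by rewrite bigcup_set1.
Qed.

(** A basic open set is a finite intersection of cylinders, and each of them that contains [x] is
    also the cylinder of the same depth around [x]; the largest depth serves them all. *)
Lemma nbhs_cylinder (x : path_space B) (K : set (path_space B)) :
  nbhs x K -> exists m, cylinder m x `<=` K.
Proof.
rewrite nbhsE => -[U [[D' sD' <-] [C D'C Cx]] UK].
have [F sF FC] : finI_from (@cylinders B) id C := sD' _ D'C.
have FP (A : set (path_space B)) : A \in F -> exists m, cylinder m x `<=` A.
  move=> AF; have : A x by move: Cx; rewrite -FC; exact.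
  have := sF _ AF; rewrite inE => -[m [e [_ ->]]] xe.
  by exists m => y yx k km; rewrite yx// xe.
suff [m mP] : exists m, forall A, A \in enum_fset F -> cylinder m x `<=` A.
  by exists m => y my; apply: UK; exists C => //; rewrite /= -FC => A /mP; exact.
have {}FP A : A \in enum_fset F -> exists m, cylinder m x `<=` A := @FP A.
elim: (enum_fset F) FP => [|A s IHs] sP; first by exists 0.
have [m mA] := sP _ (mem_head A s).
have [|n ns] := IHs; first by move=> A' A's; apply: sP; rewrite inE A's orbT.
exists (maxn m n) => A'; rewrite inE => /predU1P[->|/ns nA'] y yx.
- by apply: mA => k km; rewrite yx// leq_max km.
- by apply: nA' => k kn; rewrite yx// leq_max kn orbT.
Qed.

(** The source of the [k]-th edge is constant on each cylinder of depth [k.+1], and finitely many of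
    these cover [K]. *)
Lemma compact_src_finite (K : set (path_space B)) k : compact K ->
  finite_set [set src B (y k) | y in K].
Proof.
have [->|/set0P[x _]] := eqVneq K set0; first by rewrite image_set0.
(* The covering form of compactness is applied in a pointed space; a point of [K] serves as base
   point. *)
pose P : ptopologicalType := HB.pack (path_space B) (isPointed.Build _ x).
move=> cK; have : cover_compact (K : set P) by rewrite -compact_cover.
move=> /(_ P setT (fun y => cylinder k.+1 y)) [y _|y Ky|F _ KF].
- exact: open_cylinder.
- by exists y.
- apply: (@sub_finite_set _ _ [set src B ((y : path_space B) k) | y in [set` F]]).
    move=> _ [y /KF [z Fz zy] <-]; exists z => //.
    by rewrite (zy k).
  exact/finite_image/finite_fset.
Qed.

End Compactness.

Lemma exists_irreducible (B : bratteli) :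
  exists B' : bratteli, isomorphic B B' /\ irreducible B'.
Proof.
have [c c_inj] : exists c : vertex B -> nat, injective c.
  have /card_eqPle[/pcard_leP[c] _] := vertex_countably_infinite B.
  by exists c => u v /inj; apply; rewrite inE.
(* The code of a sequence exceeds all its entries, so the requirement (n, w, j)
   is served at a level beyond n. *)
pose serves m (f : vertex B -> vertex B) := bijective f /\
  forall n w j, m = CodeSeq.code [:: n; c w; c j] ->
  exists e, [/\ finite_path n m e, src B (e n) = w & f (rng B (e m.-1)) = j].
have /choice[g gP] m : exists f, serves m f.
  have [[[[n w] j] mE]|no] := pselect (exists q : nat * vertex B * vertex B,
      m = CodeSeq.code [:: q.1.1; c q.1.2; c q.2]); last first.
    exists id; split; first by exists id.
    by move=> n w j mE; case: no; exists (n, w, j).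
  have nm : (n < m)%N.
    by have := CodeSeq.gtn_decode m; rewrite {2}mE CodeSeq.codeK => /andP[].
  have [e [eP ew]] := finite_path_from w nm.
  have [f [f_bij fe]] := exists_bij_mapping (rng B (e m.-1)) j.
  exists f; split=> // n' w' j'; rewrite {1}mE.
  (* By injectivity of the coding, level [m] carries at most one requirement, so one transposition
     is enough. *)
  move=> /(can_inj CodeSeq.codeK)[<- /c_inj<- /c_inj<-].
  by exists e.
have g_bij m : bijective (g m) := proj1 (gP m).
exists (relabel g_bij); split; first exact: isomorphic_relabel.
(* A requirement names its source by the original vertex, here [f i], and its target by the new
   label [j]. *)
move=> i j n; have [f _ fK] := g_bij n.
have [e [eP ei ej]] := proj2 (gP _) n (f i) j erefl.
exists (CodeSeq.code [:: n; c (f i); c j]); split; first by case: eP.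
exists e; split=> //; first exact/relabel_finite_path.
  by rewrite /= ei fK.
(* With [m] the code, the end of the last edge is relabelled by [g m.-1.+1], which is [g m] because
   [m] is positive. *)
move: ej; have : (0 < CodeSeq.code [:: n; c (f i); c j])%N.
  exact: leq_ltn_trans (leq0n n) eP.1.
by case: CodeSeq.code.
Qed.

Lemma exists_reducible (B : bratteli) (x : path_space B)
    (K : set (path_space B)) : nbhs x K -> compact K ->
  exists B' : bratteli, isomorphic B B' /\ reducible B'.
Proof.
move=> /nbhs_cylinder[m mK] cK; pose j := src B (x 0).
have /choice[g gP] k : exists f : vertex B -> vertex B,
    bijective f /\ forall y, K y -> f (src B (y k)) <> j.
  have [u uK] : exists u, ~ [set src B (y k) | y in K] u.
    apply: contrapT => /forallNP all_K; apply: infinite_nat.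
    rewrite -(eq_finite_set (vertex_countably_infinite B)).
    apply: (sub_finite_set _ (compact_src_finite k cK)) => u _.
    exact: contrapT (all_K u).
  have [f [f_bij fu]] := exists_bij_mapping u j.
  exists f; split=> // y Ky; rewrite -fu => /(bij_inj f_bij) yu.
  by apply: uK; exists y.
have g_bij k : bijective (g k) := proj1 (gP k).
exists (relabel g_bij); split; first exact: isomorphic_relabel.
move=> /(_ (g m (src B (x m))) j m)[[[]//|k] [mk [e]]].
move=> [/relabel_finite_path eP /= /(bij_inj (g_bij m)) em ek].
(* Follow [x] down to level [m], then [e]; by [em] they meet at [src B (x m)]. *)
pose p l := if (l < m)%N then x l else e l.
have pP : finite_path 0 k.+1 p.
  split=> // l _ lk; rewrite /p.
  have [lm|ml|lm] := ltngtP l.+1 m.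
  - by rewrite path_edgeP.
  - exact: eP.2.
  - by move: em; rewrite -lm => ->; rewrite path_edgeP.
have [y yP] := finite_path_extend pP.
have Ky : K y.
  by apply: mK => l lm; rewrite yP /p ?lm// (ltn_trans lm).
(* At level [k.+1] the path [y] of [K] visits the end of [e], whose new label is [j], against the
   choice of [g k.+1]. *)
apply: (proj2 (gP k.+1) y Ky).
by rewrite path_edgeP yP// /p ltnNge -ltnS mk.
Qed.

Theorem theorem4p11 (B : bratteli)
    (hB : exists (x : path_space B) (K : set (path_space B)),
        nbhs x K /\ compact K) :
  relatively_irreducible B.
Proof.
have [x [K [xK cK]]] := hB.
by split; [exact: exists_reducible xK cK | exact: exists_irreducible].
Qed.
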